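(* For all positive integers $n$ and $k$, the numbers of edges of the Munarini graph $M_{n,k}$ and of the generalized Pell graph $\Pi_{n,k}$ are $$|E(M_{n,k})|=|E(\Pi_{n,k})|=\frac{(k^2-k+2)\,n\,F_{n+1,k}+(k-2)(n+1)F_{n,k}}{k^2+4}.$$
   Context: For integers $k\geq 1$, $n\geq 0$, a $k$-generalized Pell string of length $n$ is a word of length $n$ over the alphabet $\{0,1,\ldots,k\}$ in which every maximal run of the character $k$ has even length (equivalently, a concatenation of letters from $\{0,1,\ldots,k-1,kk\}$). Let $\mathcal{F}_{n,k}$ be the set of these strings (for $n=0$ it contains only the empty string). The Munarini graph $M_{n,k}$ is the simple graph with vertex set $\mathcal{F}_{n,k}$ in which two vertices are adjacent if one of them can be obtained from the other either by replacing one occurrence of $0$ with some $i\in\{1,\ldots,k-1\}$, or by replacing one substring $00$ (two consecutive positions) with $kk$ (both replacements may be read in either direction, and both strings must be in $\mathcal{F}_{n,k}$). The generalized Pell graph $\Pi_{n,k}$ is the simple graph with vertex set $\mathcal{F}_{n,k}$ in which two vertices are adjacent if one of them can be obtained from the other either by replacing one occurrence of $i$ with $i+1$ for some $i\in\{0,1,\ldots,k-2\}$, or by replacing one substring $(k-1)(k-1)$ with $kk$ (both replacements may be read in either direction, and both strings must be in $\mathcal{F}_{n,k}$). The $k$-Fibonacci numbers are defined by $F_{0,k}=0$, $F_{1,k}=1$, $F_{n,k}=kF_{n-1,k}+F_{n-2,k}$ for $n\geq 2$. *)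

(* Defs.v *)
From mathcomp Require Import all_boot.

Set Implicit Arguments.
Unset Strict Implicit.
Unset Printing Implicit Defensive.

(* The m > 0 positions i, .., i + m - 1 of s form a maximal run of c. *)
Definition maximal_run (c : nat) (s : seq nat) (i m : nat) : bool :=
  [&& 0 < m, i + m <= size s, take m (drop i s) == nseq m c,
      (i == 0) || (nth 0 s i.-1 != c) &
      (i + m == size s) || (nth 0 s (i + m) != c)].

Definition even_runs (c : nat) (s : seq nat) : bool :=
  all (fun i => all (fun m => maximal_run c s i m ==> ~~ odd m)
                    (iota 1 (size s)))
      (iota 0 (size s)).

(* t is obtained from s by replacing one occurrence of the factor a by b;
   see replacesP. *)
Definition replaces (a b s t : seq nat) : bool :=
  has (fun i => let p := take i s in let q := drop (i + size a) s in
                (s == p ++ a ++ q) && (t == p ++ b ++ q))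
      (iota 0 (size s).+1).

Lemma replacesP (a b s t : seq nat) :
  reflect (exists p q, s = p ++ a ++ q /\ t = p ++ b ++ q) (replaces a b s t).
Proof.
apply: (iffP hasP) => [[i _ /andP[/eqP es /eqP et]]|[p [q [es et]]]].
  by exists (take i s), (drop (i + size a) s).
exists (size p); first by rewrite mem_iota ltnS es size_cat leq_addr.
have ep : take (size p) s = p by rewrite es take_size_cat.
have eq : drop (size p + size a) s = q.
  by rewrite es catA drop_size_cat // size_cat.
by apply/andP; rewrite ep eq; split; apply/eqP.
Qed.

Definition word (n k : nat) : finType := n.-tuple 'I_k.+1.

Definition letters (n k : nat) (w : word n k) : seq nat :=
  [seq nat_of_ord c | c <- (w : n.-tuple 'I_k.+1)].

Definition pell_string (n k : nat) : finType :=
  {w : word n k | even_runs k (letters w)}.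

(* The letter i ranges over 1, .., k - 1. *)
Definition munarini_step (k : nat) (s t : seq nat) : bool :=
  has (fun i => replaces [:: 0] [:: i] s t) (iota 1 k.-1)
  || replaces [:: 0; 0] [:: k; k] s t.

(* The letter i ranges over 0, .., k - 2. *)
Definition pell_step (k : nat) (s t : seq nat) : bool :=
  has (fun i => replaces [:: i] [:: i.+1] s t) (iota 0 k.-1)
  || replaces [:: k.-1; k.-1] [:: k; k] s t.

Definition munarini_adj (n k : nat) : rel (pell_string n k) :=
  fun x y => let s := letters (val x) in let t := letters (val y) in
             munarini_step k s t || munarini_step k t s.

Definition pell_adj (n k : nat) : rel (pell_string n k) :=
  fun x y => let s := letters (val x) in let t := letters (val y) in
             pell_step k s t || pell_step k t s.

Definition edges (V : finType) (adj : rel V) : {set {set V}} :=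
  [set e : {set V} | [exists x, exists y, adj x y && (e == [set x; y])]].

Fixpoint kfib (k n : nat) : nat :=
  match n with
  | 0 => 0
  | m.+1 => if m is p.+1 then k * kfib k m + kfib k p else 1
  end.

Lemma munarini_adj_sym (n k : nat) : symmetric (@munarini_adj n k).
Proof. by move=> x y; rewrite /munarini_adj /= orbC. Qed.

Lemma pell_adj_sym (n k : nat) : symmetric (@pell_adj n k).
Proof. by move=> x y; rewrite /pell_adj /= orbC. Qed.

Lemma replaces_neq (a b s : seq nat) :
  size a = size b -> a != b -> replaces a b s s = false.
Proof.
move=> eq_ab ab; apply/negP => /replacesP[p [q [-> /eqP]]].
by rewrite eqseq_cat // eqxx eqseq_cat // (negPf ab).
Qed.

Lemma munarini_adj_irr (n k : nat) : 0 < k -> irreflexive (@munarini_adj n k).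
Proof.
move=> k0 x; rewrite /munarini_adj /= orbb /munarini_step replaces_neq //; last first.
  by rewrite eqseq_cons; case: k k0 x.
rewrite orbF; apply/hasP => -[i]; rewrite mem_iota => /andP[i0 _].
by rewrite replaces_neq // eqseq_cons; case: i i0.
Qed.

Lemma pell_adj_irr (n k : nat) : 0 < k -> irreflexive (@pell_adj n k).
Proof.
move=> k0 x; rewrite /pell_adj /= orbb /pell_step replaces_neq //; last first.
  by rewrite eqseq_cons -{2}(prednK k0) ltn_eqF.
rewrite orbF; apply/hasP => -[i _].
by rewrite replaces_neq // eqseq_cons ltn_eqF.
Qed.

(* Main.v *)
(** Both graphs are the underlying graph of an acyclic relation given by [k - 1]
    rewriting rules [i -> j] with [i < j < k], together with one rule
    [uu -> kk] with [u < k].  Splitting a string according to whether it starts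
    with a letter smaller than [k] or with [kk] shows that the numbers [a_n] of
    strings and [e_n] of edges satisfy [a_(n+2) = k a_(n+1) + a_n] and
    [e_(n+2) = k e_(n+1) + (k - 1) a_(n+1) + e_n + a_n], whatever the rules
    are; the closed formula solves this recurrence. *)

Require Import Defs.
From mathcomp Require Import all_boot all_order all_algebra.
From mathcomp Require Import zify ring.
Import GRing.Theory.
Local Open Scope ring_scope.

Set Implicit Arguments.
Unset Strict Implicit.
Unset Printing Implicit Defensive.

Section NatScope.
Local Open Scope nat_scope.

(** * Strings with even runs *)

Lemma even_runsP (c : nat) (s : seq nat) :
  reflect (forall i m, maximal_run c s i m -> ~~ odd m) (even_runs c s).
Proof.
apply: (iffP allP) => [h i m run|h i _]; last first.
  by apply/allP => m _; apply/implyP; apply: h.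
have /and5P[m_gt0 le_im _ _ _] := run.
have /allP/(_ m) : all (fun m => maximal_run c s i m ==> ~~ odd m)
                       (iota 1 (size s)).
  by apply: h; rewrite mem_iota; lia.
by rewrite run; apply; rewrite mem_iota; lia.
Qed.

Lemma maximal_run_consS (c d : nat) (s : seq nat) (i m : nat) : d != c ->
  maximal_run c (d :: s) i.+1 m = maximal_run c s i m.
Proof.
move=> neq_dc; rewrite /maximal_run /= addSn ltnS eqSS.
by case: i => [|i] //=; rewrite neq_dc.
Qed.

Lemma maximal_run_cons0 (c d : nat) (s : seq nat) (m : nat) : d != c ->
  maximal_run c (d :: s) 0 m = false.
Proof.
move=> neq_dc; rewrite /maximal_run; case: m => [|m] //=.
by rewrite eqseq_cons (negPf neq_dc) /= andbF.
Qed.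

Lemma even_runs_cons (c d : nat) (s : seq nat) : d != c ->
  even_runs c (d :: s) = even_runs c s.
Proof.
move=> neq_dc; apply/even_runsP/even_runsP => h i m.
  by rewrite -(maximal_run_consS _ _ _ neq_dc); apply: h.
case: i => [|i]; first by rewrite maximal_run_cons0.
by rewrite maximal_run_consS //; apply: h.
Qed.

Lemma even_runs_single (c : nat) : even_runs c [:: c] = false.
Proof.
apply/even_runsP => /(_ 0 1).
by rewrite /maximal_run /= eqxx => /(_ isT).
Qed.

Lemma even_runs_isolated (c d : nat) (s : seq nat) : d != c ->
  even_runs c [:: c, d & s] = false.
Proof.
move=> neq_dc; apply/even_runsP => /(_ 0 1).
by rewrite /maximal_run /= eqxx neq_dc => /(_ isT).
Qed.

(** The new prefix lengthens a run at position 0 by two, or creates one of length two, and shifts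
    every other run by two, so no parity changes. *)
Lemma even_runs_double (c : nat) (s : seq nat) :
  even_runs c [:: c, c & s] = even_runs c s.
Proof.
apply/even_runsP/even_runsP => h i m run.
  case: i run => [|i] run.
    have /h : maximal_run c [:: c, c & s] 0 m.+2.
      move: run; rewrite /maximal_run /= !add0n !ltnS !eqSS !eqseq_cons eqxx /=.
      by rewrite drop0; case/and4P => _ -> -> ->.
    by rewrite /= negbK.
  have /h // : maximal_run c [:: c, c & s] i.+3 m.
  by move: run; rewrite /maximal_run /= !addSn !ltnS !eqSS.
(* Positions 1 and 2 start no maximal run, since the letter before each is [c]; from position 3 on,
   the runs are those of [s] at positions at least 1. *)
case: i run => [|[|[|i]]].
- case: m => [|[|m]] //.
    by rewrite /maximal_run /= !eqxx.
  rewrite /= negbK; case: m => [|m] // run.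
  apply: (h 0 m.+1); move: run.
  by rewrite /maximal_run /= !add0n !ltnS !eqSS !eqseq_cons eqxx /= drop0.
- by rewrite /maximal_run /= eqxx !andbF.
- by rewrite /maximal_run /= eqxx !andbF.
- move=> run; apply: (h i.+1 m); move: run.
  by rewrite /maximal_run /= !addSn !ltnS !eqSS.
Qed.

(** * Recursive enumeration of the strings *)

Fixpoint pell_words (k n : nat) : seq (seq nat) :=
  if n is m.+1 then
    [seq c :: w | c <- iota 0 k, w <- pell_words k m] ++
    (if m is p.+1 then [seq [:: k, k & w] | w <- pell_words k p] else [::])
  else [:: [::]].

Lemma pell_wordsSS (k n : nat) : pell_words k n.+2 =
  [seq c :: w | c <- iota 0 k, w <- pell_words k n.+1] ++
  [seq [:: k, k & w] | w <- pell_words k n].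
Proof. by []. Qed.

Lemma mem_cons_allpairs (k c : nat) (w : seq nat) (W : seq (seq nat)) :
  (c :: w \in [seq c :: w | c <- iota 0 k, w <- W]) = (c < k) && (w \in W).
Proof.
apply/allpairsP/andP => [[[d v] /= [dk vW [-> ->]]]|[ck wW]].
  by move: dk; rewrite mem_iota.
by exists (c, w); rewrite mem_iota.
Qed.

Lemma nat_ind2 (P : nat -> Prop) :
  P 0 -> P 1 -> (forall n, P n -> P n.+1 -> P n.+2) -> forall n, P n.
Proof.
move=> P0 P1 PS n; suff [] : P n /\ P n.+1 by [].
by elim: n => [//|n [Pn PSn]]; split=> //; apply: PS.
Qed.

(** A first letter below [k] or a prefix [kk] can be removed without affecting the parity of runs,
    while a first [k] not followed by [k] is itself an odd run. *)
Lemma mem_pell_words (k n : nat) (s : seq nat) :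
  (s \in pell_words k n) =
  [&& size s == n, all (fun c => c <= k) s & even_runs k s].
Proof.
elim/nat_ind2: n s => [|| n IHn IHn1] s.
- by case: s.
- case: s => [|c [|d s]].
  + by rewrite [pell_words k 1]cats0; apply/negP => /allpairsP[p []].
  + rewrite [pell_words k 1]cats0 mem_cons_allpairs inE eqxx andbT /= andbT.
    case: ltngtP => //= [ltck|->]; last by rewrite even_runs_single.
    by rewrite even_runs_cons ?ltn_eqF.
  + by rewrite [pell_words k 1]cats0 mem_cons_allpairs andbF.
rewrite pell_wordsSS mem_cat.
case: s => [|c s].
  by apply/negP => /orP[/allpairsP[p []]|/mapP[]].
rewrite mem_cons_allpairs IHn1 /= eqSS.
have [ltck|gtck|->] := ltngtP c k => /=.
- rewrite even_runs_cons ?(ltn_eqF ltck) // [X in _ || X](_ : _ = false) ?orbF //.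
  by apply/negP => /mapP[w _ [eck _]]; rewrite eck ltnn in ltck.
- rewrite andbF; apply/negP => /mapP[w _ [eck _]].
  by rewrite eck ltnn in gtck.
case: s => [|d s] /=; first by apply/negP => /mapP[].
have [->|neq_dk] := eqVneq d k.
  rewrite leqnn even_runs_double eqSS -IHn.
  by rewrite mem_map // => v w [].
rewrite even_runs_isolated // !andbF.
by apply/negP => /mapP[w _ [edk _]]; rewrite edk eqxx in neq_dk.
Qed.

Lemma uniq_pell_words (k n : nat) : uniq (pell_words k n).
Proof.
have uniqA W : uniq W -> uniq [seq c :: w | c <- iota 0 k, w <- W].
  move=> uW; apply: allpairs_uniq => //; first exact: iota_uniq.
  by move=> [c w] [d v] _ _ /= [-> ->].
elim/nat_ind2: n => [|| n IHn IHn1] //.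
  by rewrite [pell_words k 1]cats0; apply: uniqA.
rewrite pell_wordsSS cat_uniq uniqA // map_inj_uniq; last by move=> v w [].
rewrite IHn andbT; apply/hasPn => _ /mapP[w _ ->].
by rewrite mem_cons_allpairs ltnn.
Qed.

Lemma size_pell_words (k n : nat) : size (pell_words k n) = kfib k n.+1.
Proof.
elim/nat_ind2: n => [|| n IHn IHn1] //.
  by rewrite [pell_words k 1]cats0 size_allpairs size_iota /= addn0.
by rewrite pell_wordsSS size_cat size_allpairs size_map size_iota IHn IHn1.
Qed.

Lemma letters_inj (n k : nat) : injective (@letters n k).
Proof. by move=> v w /(inj_map val_inj)/val_inj. Qed.

(** This turns sums over vertices into sums over a list that unfolds by recursion on the length. *)
Lemma perm_pell_words (n k : nat) :
  perm_eq [seq letters (val x) | x <- enum (pell_string n k)] (pell_words k n).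
Proof.
apply: uniq_perm; last 1 first.
- move=> s; rewrite mem_pell_words; apply/mapP/and3P => [[x _ ->]|].
    split; [by rewrite size_map size_tuple | | exact: valP x].
    by apply/allP => _ /mapP[c _ ->]; rewrite -ltnS.
  move=> [sz_s le_s runs_s].
  have sz_w : size [seq inord c : 'I_k.+1 | c <- s] == n by rewrite size_map.
  have es : letters (Tuple sz_w : word n k) = s.
    rewrite /letters /= -map_comp map_id_in // => c /= cs.
    by rewrite inordK // ltnS (allP le_s).
  have runs_w : even_runs k (letters (Tuple sz_w : word n k)) by rewrite es.
  by exists (Sub (Tuple sz_w : word n k) runs_w); rewrite ?mem_enum // SubK es.
- by rewrite map_inj_uniq ?enum_uniq // => x y /letters_inj/val_inj.
- exact: uniq_pell_words.
Qed.

Lemma sum_pell_string (n k : nat) (F : seq nat -> nat) :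
  \sum_(x : pell_string n k) F (letters (val x)) = \sum_(s <- pell_words k n) F s.
Proof. by rewrite -(perm_big _ (perm_pell_words n k)) big_map big_enum. Qed.

(** * Rewriting rules *)

(** The replaced factor starts either at position 0 or inside the tail; in the latter case the heads
    agree. *)
Lemma replaces_cons (a b : seq nat) (c d : nat) (s t : seq nat) :
  replaces a b (c :: s) (d :: t) =
  ((c :: s == a ++ drop (size a) (c :: s)) &&
   (d :: t == b ++ drop (size a) (c :: s)))
  || (c == d) && replaces a b s t.
Proof.
rewrite /replaces.
have -> : iota 0 (size (c :: s)).+1 = [:: 0] ++ map succn (iota 0 (size s).+1).
  by rewrite [LHS]/= -(iotaDl 1 0 (size s).+1).
rewrite has_cat has_seq1 has_map take0 add0n; congr (_ || _).
have [<-|neq_cd] := eqVneq c d.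
  by rewrite andTb; apply: eq_has => i /=; rewrite !eqseq_cons eqxx.
apply/hasP => -[i _ /=].
by rewrite !eqseq_cons [d == c]eq_sym (negPf neq_cd) andbF.
Qed.

(** Common form of [munarini_step] and [pell_step]: [L] lists the one-letter rules as pairs (source,
    target), and [u] is the letter whose square becomes [kk]. *)
Definition rule_step (L : seq (nat * nat)) (u k : nat) (s t : seq nat) : bool :=
  has (fun p => replaces [:: p.1] [:: p.2] s t) L
  || replaces [:: u; u] [:: k; k] s t.

Definition increasing_rules (L : seq (nat * nat)) (u k : nat) : bool :=
  [&& uniq L, all (fun p => p.1 < p.2 < k) L & u < k].

Lemma rule_step_cons (L : seq (nat * nat)) (u k c d : nat) (s t : seq nat) :
  rule_step L u k (c :: s) (d :: t) =
  [|| ((c, d) \in L) && (s == t),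
      [&& c == u, d == k, s == u :: drop 1 s & t == k :: drop 1 s]
    | (c == d) && rule_step L u k s t].
Proof.
rewrite /rule_step replaces_cons /= !eqseq_cons.
have -> : has (fun p => replaces [:: p.1] [:: p.2] (c :: s) (d :: t)) L =
  (((c, d) \in L) && (s == t)) ||
  (c == d) && has (fun p => replaces [:: p.1] [:: p.2] s t) L.
  elim: L => [|[x y] L IH] /=; first by rewrite andbF.
  rewrite IH replaces_cons /= drop0 !eqseq_cons eqxx inE xpair_eqE [t == s]eq_sym.
  case: (replaces _ _ s t); case: (has _ L); case: (_ \in L);
  by case: (s == t); case: (c == d); case: (c == x); case: (d == y).
case: (replaces _ _ s t); case: (has _ L); case: (_ \in L);
case: (s == t); case: (c == d); case: (c == u); case: (d == k);
by case: (s == _); case: (t == _).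
Qed.

(** Every rule raises the letters it touches. The letter sum is thus a potential that orients each
    edge. *)
Lemma rule_step_sumn (L : seq (nat * nat)) (u k : nat) (s t : seq nat) :
  increasing_rules L u k -> rule_step L u k s t -> sumn s < sumn t.
Proof.
case/and3P => _ /allP ltL ltuk; case/orP.
  case/hasP => -[x y] /ltL /= ltxy /replacesP[p [q [-> ->]]].
  by rewrite !sumn_cat /=; lia.
by case/replacesP => p [q [-> ->]]; rewrite !sumn_cat /=; lia.
Qed.

(** With a target head below [k], the double rule cannot act at the head. The two remaining cases
    exclude each other, as a rule never maps a letter to itself, so the disjunction becomes a
    sum. *)
Lemma rule_step_small (L : seq (nat * nat)) (u k c d : nat) (s t : seq nat) :
  increasing_rules L u k -> d < k ->
  rule_step L u k (c :: s) (d :: t) =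
  (c == d) && rule_step L u k s t + ((c, d) \in L) && (s == t) :> nat.
Proof.
case/and3P => _ /allP ltL _ ltdk; rewrite rule_step_cons (ltn_eqF ltdk) andbF /=.
have [->|_] /= := eqVneq c d; last by rewrite orbF.
have [/ltL/=|_] := boolP ((d, d) \in L); first by lia.
by rewrite /= addn0.
Qed.

Lemma rule_step_to_double (L : seq (nat * nat)) (u k c : nat) (s t : seq nat) :
  increasing_rules L u k -> c < k ->
  rule_step L u k (c :: s) [:: k, k & t] = (c == u) && (s == u :: t).
Proof.
case/and3P => _ /allP ltL _ ltck; rewrite rule_step_cons (ltn_eqF ltck) orbF.
have [/ltL/=|_] := boolP ((c, k) \in L); first by lia.
rewrite !eqxx /= !eqseq_cons eqxx /=; congr (_ && _).
case: s => [|d s] //=; rewrite drop0 !eqseq_cons eqxx andbT.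
by rewrite [t == s]eq_sym.
Qed.

(** No rule has the letter [k] in its source, so a leading [k] persists. *)
Lemma rule_step_from_double (L : seq (nat * nat)) (u k d : nat) (s t : seq nat) :
  increasing_rules L u k -> d < k ->
  rule_step L u k [:: k, k & s] (d :: t) = false.
Proof.
move=> incL ltdk; have := rule_step_small k (k :: s) t incL ltdk.
have /and3P[_ /allP ltL _] := incL.
rewrite (gtn_eqF ltdk); have [/ltL/=|_] := boolP ((k, d) \in L); first by lia.
by case: rule_step.
Qed.

Lemma rule_step_max (L : seq (nat * nat)) (u k : nat) (s t : seq nat) :
  increasing_rules L u k ->
  rule_step L u k (k :: s) (k :: t) = rule_step L u k s t.
Proof.
case/and3P => _ /allP ltL ltuk; rewrite rule_step_cons eqxx (gtn_eqF ltuk) /=.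
by have [/ltL/=|_] := boolP ((k, k) \in L); first by lia.
Qed.

(** * Counting steps *)

Definition steps (L : seq (nat * nat)) (u k n : nat) : nat :=
  \sum_(s <- pell_words k n) \sum_(t <- pell_words k n) rule_step L u k s t.

Lemma sum_eq_mem (T : eqType) (S : seq T) (x : T) :
  uniq S -> \sum_(y <- S) (x == y) = (x \in S).
Proof.
move=> uS; rewrite -(count_uniq_mem _ uS) -sum1_count [RHS]big_mkcond /=.
by apply: eq_bigr => y _; rewrite eq_sym; case: eqP.
Qed.

Lemma sum_rules (L : seq (nat * nat)) (u k : nat) : increasing_rules L u k ->
  \sum_(c <- iota 0 k) \sum_(d <- iota 0 k) ((c, d) \in L) = size L.
Proof.
case/and3P => uL /allP ltL _.
(* Both letters of every rule are below [k], so selecting the rules from the full square of letters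
   recovers [L] up to order. *)
have permL : perm_eq L
    [seq p <- [seq (c, d) | c <- iota 0 k, d <- iota 0 k] | p \in L].
  apply: uniq_perm => //.
    by rewrite filter_uniq // allpairs_uniq ?iota_uniq // => -[? ?] [? ?] _ _ [-> ->].
  move=> [c d]; rewrite mem_filter; have [/ltL/= ltcd|//] := boolP (_ \in L).
  by apply/esym/allpairsP; exists (c, d); rewrite !mem_iota; split=> //=; lia.
rewrite -(big_allpairs (F := fun p => p \in L : nat)) -sum1_size.
rewrite [RHS](perm_big _ permL) big_filter [RHS]big_mkcond.
by apply: eq_bigr => p _; case: (_ \in _).
Qed.

(** Equal heads leave a step between the tails, for each of [k] letters; heads related by a rule
    force equal tails, for each of [size L] rules. *)
Lemma sum_small_steps (L : seq (nat * nat)) (u k n : nat) :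
  increasing_rules L u k ->
  \sum_(s <- [seq c :: w | c <- iota 0 k, w <- pell_words k n])
    \sum_(t <- [seq c :: w | c <- iota 0 k, w <- pell_words k n])
      rule_step L u k s t = k * steps L u k n + size L * kfib k n.+1.
Proof.
move=> incL; rewrite big_allpairs_dep.
transitivity (\sum_(c <- iota 0 k) \sum_(d <- iota 0 k)
   ((c == d) * steps L u k n + ((c, d) \in L) * kfib k n.+1)).
  apply: eq_bigr => c _.
  under eq_bigr do rewrite big_allpairs_dep.
  (* The target head [d] is moved outermost, where its bound [d < k] is available for
     [rule_step_small]. *)
  rewrite exchange_big; apply: eq_big_seq => d; rewrite mem_iota /= => ltdk.
  under eq_bigr => s _.
    under eq_bigr => t _ do rewrite rule_step_small // -!mulnb.
    rewrite big_split -!big_distrr /=; over.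
  rewrite big_split -!big_distrr /=; congr (_ + _ * _).
  rewrite -[RHS]/(kfib k n.+1) -size_pell_words -sum1_size; apply: eq_big_seq => s s_in.
  by rewrite sum_eq_mem ?uniq_pell_words // s_in.
under eq_bigr do rewrite big_split -!big_distrl /=.
rewrite big_split -!big_distrl /= (sum_rules incL); congr (_ * _ + _).
transitivity (\sum_(c <- iota 0 k) 1); last by rewrite sum1_size size_iota.
by apply: eq_big_seq => c c_in; rewrite sum_eq_mem ?iota_uniq // c_in.
Qed.

Lemma steps0 (L : seq (nat * nat)) (u k : nat) : increasing_rules L u k ->
  steps L u k 0 = 0.
Proof.
move=> incL; rewrite /steps !big_seq1.
by case: (boolP (rule_step _ _ _ _ _)) => // /(rule_step_sumn incL).
Qed.

Lemma steps1 (L : seq (nat * nat)) (u k : nat) : increasing_rules L u k ->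
  steps L u k 1 = size L.
Proof.
move=> incL; rewrite /steps [pell_words k 1]cats0.
by rewrite (sum_small_steps 0 incL) steps0 // muln0 muln1.
Qed.

(** Source and target each start with a small letter or with [kk], which gives four blocks. Small to
    small is [sum_small_steps], [kk] to [kk] copies the steps of length [n], [kk] to small is empty,
    and small to [kk] has one step per tail. *)
Lemma stepsSS (L : seq (nat * nat)) (u k n : nat) : increasing_rules L u k ->
  steps L u k n.+2 = k * steps L u k n.+1 + size L * kfib k n.+2
                     + steps L u k n + kfib k n.+1.
Proof.
move=> incL; have /and3P[_ _ ltuk] := incL.
rewrite {1}/steps pell_wordsSS big_cat /=.
under eq_bigr do rewrite big_cat /=.
under [X in _ + X = _]eq_bigr do rewrite big_cat /=.
rewrite !big_split /= (sum_small_steps n.+1 incL) -!addnA.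
do 2!congr (_ + _); rewrite addnC; congr (_ + _).
  rewrite big_map big1 ?add0n; last first.
    move=> s _; rewrite big_seq big1 // => _ /allpairsP[[d t] /= [ltdk _ ->]].
    by rewrite rule_step_from_double //; move: ltdk; rewrite mem_iota.
  rewrite big_map; apply: eq_bigr => s _; rewrite big_map; apply: eq_bigr => t _.
  by rewrite !rule_step_max.
rewrite exchange_big big_map -[RHS]/(kfib k n.+1) -size_pell_words -sum1_size.
apply: eq_big_seq => t t_in.
(* The only source with a small head that reaches [kkt] is [uut], which occurs exactly once in the
   enumeration. *)
transitivity (\sum_(s <- [seq c :: w | c <- iota 0 k, w <- pell_words k n.+1])
                ([:: u, u & t] == s)).
  apply: eq_big_seq => _ /allpairsP[[c s] /= [ltck _ ->]].
  rewrite rule_step_to_double //; last by move: ltck; rewrite mem_iota.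
  by rewrite eqseq_cons [u == c]eq_sym [_ == s]eq_sym.
have := uniq_pell_words k n.+2; rewrite pell_wordsSS cat_uniq => /andP[uA _].
rewrite sum_eq_mem // mem_cons_allpairs ltuk /= mem_cat mem_cons_allpairs.
by rewrite ltuk t_in.
Qed.

(** * From oriented steps to edges *)

(** Since [f] strictly increases along [st], no pair is related in both directions or to itself, so
    each edge comes from exactly one ordered pair. *)
Lemma card_edges_oriented (V : finType) (adj st : rel V) (f : V -> nat) :
  (forall x y, adj x y = st x y || st y x) ->
  (forall x y, st x y -> f x < f y) ->
  #|edges adj| = \sum_x \sum_y st x y.
Proof.
move=> adjE st_f.
pose S := [set p : V * V | st p.1 p.2].
have -> : edges adj = [set [set p.1; p.2] | p in S].
  apply/setP => e; rewrite inE; apply/existsP/imsetP.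
    move=> [x /existsP[y /andP[]]]; rewrite adjE => /orP[] xy /eqP->.
      by exists (x, y); rewrite ?inE.
    by exists (y, x); rewrite ?inE //= setUC.
  move=> [[x y]]; rewrite inE /= => xy ->.
  by exists x; apply/existsP; exists y; rewrite adjE xy eqxx.
rewrite card_in_imset; last first.
  move=> [x y] [x' y']; rewrite !inE /= => /st_f fxy /st_f fxy' /setP eqE.
  (* Equal edges match the endpoints directly or swapped; the swap would give [f x < f y < f x]. *)
  have := eqE x; have := eqE y; rewrite !inE !eqxx orbT /= => /esym yE /esym xE.
  move: fxy fxy'; case/orP: xE => /eqP->; case/orP: yE => /eqP->; rewrite ?ltnn //.
  by move=> lt1 /(ltn_trans lt1); rewrite ltnn.
rewrite -sum1_card pair_big big_mkcond /=.
by apply: eq_bigr => p _; rewrite inE; case: (st _ _).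
Qed.

Lemma card_edges_steps (n k u : nat) (L : seq (nat * nat))
    (adj : rel (pell_string n k)) :
  increasing_rules L u k ->
  (forall x y, adj x y = rule_step L u k (letters (val x)) (letters (val y))
                      || rule_step L u k (letters (val y)) (letters (val x))) ->
  #|edges adj| = steps L u k n.
Proof.
move=> incL adjE.
rewrite (card_edges_oriented (f := fun x => sumn (letters (val x))) adjE).
  under eq_bigr => x _ do
    rewrite (@sum_pell_string n k (fun t => rule_step L u k (letters (val x)) t)).
  exact: (@sum_pell_string n k
    (fun s => \sum_(t <- pell_words k n) rule_step L u k s t)).
by move=> x y; apply: rule_step_sumn.
Qed.

(** * The two rule systems *)

Definition munarini_rules (k : nat) := [seq (0, i) | i <- iota 1 k.-1].

Definition pell_rules (k : nat) := [seq (i, i.+1) | i <- iota 0 k.-1].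

Lemma increasing_munarini_rules (k : nat) :
  0 < k -> increasing_rules (munarini_rules k) 0 k.
Proof.
move=> k_gt0; apply/and3P; split=> //.
  by rewrite map_inj_uniq ?iota_uniq // => i j [].
by apply/allP => _ /mapP[i + ->] /=; rewrite mem_iota; lia.
Qed.

Lemma increasing_pell_rules (k : nat) :
  0 < k -> increasing_rules (pell_rules k) k.-1 k.
Proof.
move=> k_gt0; apply/and3P; split; last by lia.
  by rewrite map_inj_uniq ?iota_uniq // => i j [].
by apply/allP => _ /mapP[i + ->] /=; rewrite mem_iota; lia.
Qed.

Lemma card_munarini_edges (n k : nat) : 0 < k ->
  #|edges (@munarini_adj n k)| = steps (munarini_rules k) 0 k n.
Proof.
move=> k_gt0; apply: card_edges_steps (increasing_munarini_rules k_gt0) _.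
by move=> x y; rewrite /munarini_adj /munarini_step /rule_step !has_map.
Qed.

Lemma card_pell_edges (n k : nat) : 0 < k ->
  #|edges (@pell_adj n k)| = steps (pell_rules k) k.-1 k n.
Proof.
move=> k_gt0; apply: card_edges_steps (increasing_pell_rules k_gt0) _.
by move=> x y; rewrite /pell_adj /pell_step /rule_step !has_map.
Qed.

(** The initial values and the recurrence [stepsSS] see the rules only through [size L]. This is why
    the two graphs have equally many edges. *)
Lemma steps_eq (L L' : seq (nat * nat)) (u u' k n : nat) :
  increasing_rules L u k -> increasing_rules L' u' k -> size L = size L' ->
  steps L u k n = steps L' u' k n.
Proof.
move=> incL incL' eqLL'; elim/nat_ind2: n => [|| n IHn IHn1].
- by rewrite !steps0.
- by rewrite !steps1.
- by rewrite !stepsSS // IHn IHn1 eqLL'.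
Qed.

End NatScope.

(** * Solving the recurrence *)

(** Clearing the denominator makes each case of the two-step induction a polynomial identity;
    working in [rat] makes the differences genuine, [k - 2] being negative for [k = 1]. *)
Lemma steps_closed_form (L : seq (nat * nat)) (u k n : nat) : (0 < k)%N ->
  increasing_rules L u k -> size L = k.-1 ->
  (k%:R ^+ 2 + 4) * (steps L u k n)%:R =
    (k%:R ^+ 2 - k%:R + 2) * n%:R * (kfib k n.+1)%:R
     + (k%:R - 2) * (n%:R + 1) * (kfib k n)%:R :> rat.
Proof.
move=> k_gt0 incL szL.
have szLE : (size L)%:R = k%:R - 1 :> rat.
  by rewrite szL -{2}(prednK k_gt0) -natr1 addrK.
have kfibSS m : (kfib k m.+2)%:R = k%:R * (kfib k m.+1)%:R + (kfib k m)%:R :> rat.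
  by rewrite -natrM -natrD.
elim/nat_ind2: n => [|| n IHn IHn1].
- by rewrite steps0 //=; ring.
- by rewrite steps1 // szLE kfibSS /=; ring.
rewrite stepsSS // !natrD !natrM szLE.
(* The factor [k ^ 2 + 4] is distributed so that both induction hypotheses apply; [kfibSS] then
   reduces everything to [kfib k n] and [kfib k n.+1]. *)
transitivity (k%:R * ((k%:R ^+ 2 + 4) * (steps L u k n.+1)%:R)
  + (k%:R ^+ 2 + 4) * (steps L u k n)%:R
  + (k%:R ^+ 2 + 4) * ((k%:R - 1) * (kfib k n.+2)%:R + (kfib k n.+1)%:R) : rat).
  by ring.
by rewrite IHn IHn1 !kfibSS -!natr1; ring.
Qed.

Theorem proposition2p8 (n k : nat) (hn : (0 < n)%N) (hk : (0 < k)%N) :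
  #|edges (@munarini_adj n k)| = #|edges (@pell_adj n k)| /\
  #|edges (@pell_adj n k)|%:R =
    ((k%:R ^+ 2 - k%:R + 2) * n%:R * (kfib k n.+1)%:R
     + (k%:R - 2) * (n%:R + 1) * (kfib k n)%:R) / (k%:R ^+ 2 + 4) :> rat.
Proof.
have incM := increasing_munarini_rules hk.
have incP := increasing_pell_rules hk.
rewrite card_munarini_edges // card_pell_edges //; split.
  by apply: steps_eq => //; rewrite !size_map !size_iota.
rewrite -(steps_closed_form _ hk incP) ?size_map ?size_iota //.
have nz : k%:R ^+ 2 + 4 != 0 :> rat.
  by rewrite -natrX -natrD Num.Theory.pnatr_eq0 addn_eq0 andbF.
by rewrite mulrC mulKf.
Qed.
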